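(* Consider the repair MDP described in the context, and consider the modified MDP with the same states, actions and transition probabilities in which the single-step reward for being in state $\mathbf{x}=(i,(x_1,\dots,x_m))\in S$ and choosing action $a\in A_{\mathbf{x}}$ is $$r(\mathbf{x},a)=\begin{cases}\dfrac{\mu_i}{\lambda_i}\,[f_i(K_i)-f_i(x_i-1)],&\text{if }i\in M,\ x_i\ge 1\text{ and }a=i,\\[2mm] 0,&\text{otherwise,}\end{cases}$$ and the objective is to maximize the long-run average reward $$u_\theta(\mathbf{x}):=\limsup_{t\to\infty}t^{-1}\mathbb{E}_\theta\Big[\sum_{n=0}^{t-1}r(\mathbf{x}_n,\theta(\mathbf{x}_n))\,\Big|\,\mathbf{x}_0=\mathbf{x}\Big],\qquad\mathbf{x}\in S.$$ Then any stationary policy which maximizes the long-run average reward $u_\theta(\mathbf{x})$ (for all $\mathbf{x}\in S$) in the modified MDP also minimizes the long-run average cost $g_\theta(\mathbf{x})$ (for all $\mathbf{x}\in S$) in the original MDP.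
   Context: Repair MDP. Let $G=(V,E)$ be a finite connected graph, $M\subseteq V$ a set of $m\ge 2$ nodes called machines (labelled $1,\dots,m$), and $N=V\setminus M$ the set of intermediate stages. For each machine $j\in M$ there are an integer $K_j\ge 1$, a degradation rate $\lambda_j>0$, a repair rate $\mu_j>0$, and a strictly increasing cost function $f_j:\{0,1,\dots,K_j\}\to\mathbb{R}$ with $f_j(0)=0$. There is a switching rate $\tau>0$. Units of time are scaled so that $\sum_{j\in M}\lambda_j+\max\{\mu_1,\dots,\mu_m,\tau\}=1$ (so rates serve as one-step transition probabilities of the uniformized discrete-time MDP). The state space is $S=\{(i,(x_1,\dots,x_m)) : i\in V,\ x_j\in\{0,1,\dots,K_j\}\text{ for }j\in M\}$, where $i$ is the node occupied by the single repairer and $x_j$ is the condition of machine $j$. For $\mathbf{x}=(i,(x_1,\dots,x_m))$, let $R(\mathbf{x})$ be the set of nodes adjacent to $i$ and let $A_{\mathbf{x}}=\{i\}\cup R(\mathbf{x})$ be the set of actions. For distinct states $\mathbf{x}=(i,(x_1,\dots,x_m))$, $\mathbf{x}'=(i',(x_1',\dots,x_m'))$ in $S$ and $a\in A_{\mathbf{x}}$, the transition probability $p_{\mathbf{x},\mathbf{x}'}(a)$ equals: $\lambda_j$ if $i'=i$, $x_j'=x_j+1$ for some $j\in M$ and $x_l'=x_l$ for $l\ne j$; $\mu_i$ if $i\in M$, $i'=i$, $x_i'=x_i-1$, $x_j'=x_j$ for $j\neq i$, and $a=i$; $\tau$ if $i'\in R(\mathbf{x})$, $x_j'=x_j$ for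 all $j\in M$, and $a=i'$; and $0$ otherwise. Also $p_{\mathbf{x},\mathbf{x}}(a)=1-\sum_{\mathbf{y}\ne\mathbf{x}}p_{\mathbf{x},\mathbf{y}}(a)$. $\Theta$ denotes the set of all admissible policies (rules for choosing, at each time step, an action available in the current state); maximization and minimization are over $\Theta$. A stationary policy $\theta$ chooses the same action $\theta(\mathbf{x})\in A_{\mathbf{x}}$ every time the system is in state $\mathbf{x}$; for a non-stationary policy, $\theta(\mathbf{x}_n)$ in the definition of $u_\theta$ is read as the action chosen at time step $n$. In the original MDP the one-step cost in state $\mathbf{x}$ is $c(\mathbf{x})=\sum_{j\in M}f_j(x_j)$, and the long-run average cost is $g_\theta(\mathbf{x})=\liminf_{t\to\infty}t^{-1}\mathbb{E}_\theta\big[\sum_{n=0}^{t-1}c(\mathbf{x}_n)\mid\mathbf{x}_0=\mathbf{x}\big]$, where $\mathbf{x}_n$ is the state at time step $n$. *)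

(* Defs.v *)
From HB Require Import structures.
From mathcomp Require Import all_boot all_order all_algebra.
From mathcomp Require Import all_classical all_reals all_analysis.

Set Implicit Arguments.
Unset Strict Implicit.
Unset Printing Implicit Defensive.
Import Order.TTheory GRing.Theory Num.Theory.

Local Open Scope ring_scope.

(* The [machine]s of the problem form the finite subtype of the nodes that
   belong to [machines]; [val j : V] is the node of the machine [j].
   The condition of machine [j] ranges over 'I_(K j).+1 = {0, ..., K j}. *)
Record repair_problem (R : realType) (V : finType) := RepairProblem {
  adj : rel V;
  adj_sym : symmetric adj;
  adj_irr : irreflexive adj;
  adj_connected : forall v w : V, connect adj v w;
  machines : {set V};
  machines_ge2 : (2 <= #|machines|)%N;
  machine : finType := {v : V | v \in machines};
  K : machine -> nat;
  K_ge1 : forall j, (1 <= K j)%N;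
  lambda : machine -> R;
  lambda_gt0 : forall j, 0 < lambda j;
  mu : machine -> R;
  mu_gt0 : forall j, 0 < mu j;
  cost : forall j : machine, 'I_(K j).+1 -> R;
  cost_incr : forall (j : machine) (k l : 'I_(K j).+1),
    (k < l)%N -> cost k < cost l;
  cost0 : forall j : machine, cost (ord0 : 'I_(K j).+1) = 0;
  tau : R;
  tau_gt0 : 0 < tau;
  time_scale : \sum_j lambda j + \big[Num.max/tau]_j mu j = 1
}.
Arguments cost {R V} r j _.

Section RepairMDP.
Variables (R : realType) (V : finType) (P : repair_problem R V).

Definition state : finType :=
  (V * {dffun forall j : machine P, 'I_(K j).+1})%type.

Definition neighbours (x : state) : {set V} := [set v | adj P x.1 v].

Definition actions (x : state) : {set V} := x.1 |: neighbours x.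

Definition degrades (j : machine P) (x y : state) : bool :=
  [&& y.1 == x.1, (y.2 j == (x.2 j).+1 :> nat) &
      [forall l, (l != j) ==> (y.2 l == x.2 l)]].

(* [x.2 j == (y.2 j).+1] says x'_j = x_j - 1 without truncation *)
Definition repairs (j : machine P) (x y : state) : bool :=
  [&& x.1 == val j, y.1 == x.1, (x.2 j == (y.2 j).+1 :> nat) &
      [forall l, (l != j) ==> (y.2 l == x.2 l)]].

Definition moves (x y : state) : bool :=
  (y.1 \in neighbours x) && (y.2 == x.2).

(* meaningful for x != y; the first two cases select at most one machine *)
Definition trans_neq (x y : state) (a : V) : R :=
  if [pick j | degrades j x y] is Some j then lambda j
  else if [pick j | repairs j x y && (a == x.1)] is Some j then mu j
  else if moves x y && (a == y.1) then tau P
  else 0.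

Definition trans (x y : state) (a : V) : R :=
  if y == x then 1 - \sum_(z | z != x) trans_neq x z a else trans_neq x y a.

Definition state_cost (x : state) : R := \sum_(j : machine P) cost P j (x.2 j).

(* [inord k] is the element k of 'I_(K j).+1 *)
Definition reward (x : state) (a : V) : R :=
  if [pick j : machine P | [&& x.1 == val j, (1 <= x.2 j)%N & a == x.1]]
    is Some j
  then mu j / lambda j * (cost P j ord_max - cost P j (inord (x.2 j).-1))
  else 0.

(* A policy may be randomized and history-dependent: [pol h x a] is the
   probability of choosing [a] in the current state [x] when [h] lists, in
   chronological order, the earlier pairs (state, chosen action). *)
Record policy := Policy {
  pol :> seq (state * V) -> state -> V -> R;
  pol_ge0 : forall h x a, 0 <= pol h x a;
  pol_sum1 : forall h x, \sum_a pol h x a = 1;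
  pol_actions : forall h x a, a \notin actions x -> pol h x a = 0
}.

Definition stationary (theta : policy) : Prop :=
  exists d : state -> V, forall h x a, theta h x a = (a == d x)%:R.

(* Probability that the next pairs (state, action) are [w], given the history
   [h] and given that the current state has distribution [nu]. *)
Fixpoint path_prob (theta : policy) (h : seq (state * V)) (nu : state -> R)
    (w : seq (state * V)) : R :=
  if w is (x, a) :: w' then
    nu x * theta h x a
    * path_prob theta (rcons h (x, a)) (fun y => trans x y a) w'
  else 1.

(* E_theta [ sum_(n < t) F (x_n) (a_n) | x_0 = x0 ], written as a finite sum
   over the trajectories (x_0, a_0), ..., (x_(t-1), a_(t-1)) *)
Definition expected_total (theta : policy) (F : state -> V -> R)
    (x0 : state) (t : nat) : R :=
  \sum_(w : t.-tuple (state * V))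
    path_prob theta [::] (fun x => (x == x0)%:R) w
    * \sum_(n < t) F (tnth w n).1 (tnth w n).2.

Definition avg_cost (theta : policy) (x : state) : \bar R :=
  limn_einf (fun t : nat =>
    (t%:R^-1 * expected_total theta (fun y _ => state_cost y) x t)%:E).

Definition avg_reward (theta : policy) (x : state) : \bar R :=
  limn_esup (fun t : nat =>
    (t%:R^-1 * expected_total theta reward x t)%:E).

Definition maximizes_avg_reward (theta : policy) : Prop :=
  forall (theta' : policy) (x : state),
    (avg_reward theta' x <= avg_reward theta x)%E.

Definition minimizes_avg_cost (theta : policy) : Prop :=
  forall (theta' : policy) (x : state),
    (avg_cost theta x <= avg_cost theta' x)%E.

End RepairMDP.

(* Main.v *)
Require Import Defs.
From mathcomp Require Import all_boot all_order all_algebra.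
From mathcomp Require Import all_classical all_reals all_analysis.
From mathcomp Require Import ring lra.

Set Implicit Arguments.
Unset Strict Implicit.
Unset Printing Implicit Defensive.
Import Order.TTheory GRing.Theory Num.Theory.
Local Open Scope ring_scope.

(** The average cost of each policy is one and the same constant minus its
    average reward, so the two objectives order all policies alike.

    The identity comes from a potential that separates over the machines. Let
    the potential of machine [j] change by [(f_j(k) - f_j(K_j)) / lambda_j] when
    its condition goes from [k] to [k + 1]. Degradation happens at rate
    [lambda_j] unless [k = K_j], so it makes the expected potential drift by
    [f_j(k) - f_j(K_j)] per step, for all [k] up to and including [K_j]. A
    repair undoes one such increment at rate [mu_j], and its contribution to the
    drift is exactly the reward. Switching nodes leaves the potential alone.
    Hence in each state and for each action the drift of the potential is
    (cost + reward - sum of the [f_j(K_j)]), which is [drift_potential].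

    Summing the drift along a trajectory telescopes. The potential is bounded on
    the finite state space, so the expected total cost and the expected total
    reward over [t] steps add up to [t] times the constant, up to an error
    independent of [t] and of the policy ([expected_total_balance]). Dividing by
    [t] gives [avg_costE]: the sign change between cost and reward is what turns
    the limit inferior of the costs into the limit superior of the rewards. *)

(** * Finite sums and limits superior *)

(** Turns a choice among mutually exclusive alternatives, followed by a default
    value, into a plain sum, to which linearity applies. *)
Lemma if_pick_sum (U : nmodType) (I : finType) (Q : pred I) (F : I -> U)
    (d : U) :
  (forall i j, Q i -> Q j -> i = j) -> ([exists j, Q j] -> d = 0) ->
  (if [pick j | Q j] is Some j then F j else d) = \sum_(j | Q j) F j + d.
Proof.
move=> Quniq d0; case: pickP => [j Qj|Q0]; last by rewrite big_pred0 // add0r.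
rewrite (big_pred1 j) => [|i]; last first.
  by apply/idP/eqP => [Qi|->//]; exact: Quniq.
by rewrite d0 ?addr0//; apply/existsP; exists j.
Qed.

Lemma sum_tuple_cons (U : nmodType) (T : finType) (t : nat)
    (H : t.+1.-tuple T -> U) :
  \sum_w H w = \sum_p \sum_(w : t.-tuple T) H (cons_tuple p w).
Proof.
rewrite pair_big /=.
rewrite (reindex (fun q : T * t.-tuple T => cons_tuple q.1 q.2)) //=.
exists (fun w => (thead w, behead_tuple w)) => [[p w] _|w _] /=.
  by congr pair; apply: val_inj.
by apply: val_inj => /=; rewrite [in RHS](tuple_eta w).
Qed.

(** The constant is inside this comparison because addition on the extended
    reals cancels only for finite terms: with a real [c] the shift can be moved
    across freely, whether or not the limits superior are finite. *)
Lemma le_limn_esup_near (R : realType) (u v : nat -> R) (c : R) :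
  (forall e : R, 0 < e -> \forall n \near \oo%classic, u n <= v n + c + e) ->
  (limn_esup (fun n => (u n)%:E) <= limn_esup (fun n => (v n)%:E) + c%:E)%E.
Proof.
move=> uv; apply/lee_addgt0Pr => e e0; rewrite -addeA -EFinD -leeBlDr//.
apply: le_ereal_inf_tmp => _ [W oW <-]; rewrite leeBlDr//.
(* Only the tail of the sequence is controlled, so the supremum over [W] is
   compared with the one over the part of [W] where the inequality holds. *)
pose W' := (W `&` [set n | u n <= v n + c + e])%classic.
apply: le_trans (_ : ereal_sup ((fun n => (u n)%:E) @` W')%classic <= _)%E.
  by apply: ereal_inf_lbound; exists W' => //; apply: filterI => //; exact: uv.
apply: ge_ereal_sup => _ [n [Wn uvn] <-].
apply: le_trans (_ : (v n + (c + e))%:E <= _)%E.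
  by rewrite lee_fin addrA.
rewrite [leLHS]EFinD; apply: leeD2r.
by apply: ereal_sup_ubound; exists n.
Qed.

(** * Trajectory sums *)

Section Trajectories.
Variables (R : realType) (V : finType) (P : repair_problem R V).
Variable theta : policy P.
Implicit Types (x y : state P) (a : V) (h : seq (state P * V)).
Implicit Types (nu G : state P -> R) (F : state P -> V -> R).

(** Expected total of [F] over [t] steps, for an arbitrary past [h] and an
    arbitrary distribution [nu] of the current state: conditioning on the first
    step changes both, so an induction on [t] needs them free. *)
Definition path_total h nu F t : R :=
  \sum_(w : t.-tuple (state P * V))
    path_prob theta h nu w * \sum_(p <- w) F p.1 p.2.

Lemma expected_totalE F x t :
  expected_total theta F x t = path_total [::] (fun y => (y == x)%:R) F t.
Proof.
apply: eq_bigr => w _.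
by rewrite -(big_tuple _ _ w xpredT (fun p => F p.1 p.2)).
Qed.

Lemma sum_trans x a : \sum_y trans x y a = 1.
Proof.
rewrite (bigD1 x) //= /trans eqxx.
under [X in _ + X]eq_bigr => y /negbTE yx do rewrite yx.
by rewrite subrK.
Qed.

Lemma sum_state_action h nu G :
  \sum_p nu p.1 * theta h p.1 p.2 * G p.1 = \sum_x nu x * G x.
Proof.
rewrite -(pair_big xpredT xpredT (fun x a => nu x * theta h x a * G x)) /=.
apply: eq_bigr => x _; rewrite -big_distrl -big_distrr /=.
by rewrite pol_sum1 mulr1.
Qed.

Lemma path_mass h nu t : \sum_x nu x = 1 ->
  \sum_(w : t.-tuple (state P * V)) path_prob theta h nu w = 1.
Proof.
elim: t h nu => [|t IH] h nu nu1.
  by rewrite (big_pred1 [tuple]) // => w; apply/esym/eqP; exact: tuple0.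
rewrite sum_tuple_cons.
transitivity (\sum_p nu p.1 * theta h p.1 p.2 * 1).
  apply: eq_bigr => -[x a] _ /=.
  by rewrite -big_distrr /= IH // sum_trans.
by rewrite (sum_state_action h nu (fun=> 1)) -big_distrl /= nu1 mulr1.
Qed.

Lemma path_total_recl h nu F t :
  path_total h nu F t.+1 =
  \sum_p nu p.1 * theta h p.1 p.2 *
    (F p.1 p.2 + path_total (rcons h p) (trans p.1 ^~ p.2) F t).
Proof.
rewrite /path_total sum_tuple_cons; apply: eq_bigr => -[x a] _ /=.
rewrite -[F x a]mulr1 -(@path_mass (rcons h (x, a)) _ t (sum_trans x a)).
rewrite mulr_sumr -big_split /= mulr_sumr; apply: eq_bigr => w _.
by rewrite big_cons /=; ring.
Qed.

Lemma path_totalD h nu F F' t :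
  path_total h nu (fun x a => F x a + F' x a) t =
  path_total h nu F t + path_total h nu F' t.
Proof.
rewrite /path_total -big_split; apply: eq_bigr => w _ /=.
by rewrite big_split mulrDr.
Qed.

Lemma path_total_cst h nu (c : R) t : \sum_x nu x = 1 ->
  path_total h nu (fun _ _ => c) t = t%:R * c.
Proof.
move=> nu1; rewrite mulr_natl -[RHS]mul1r -[X in X * _](path_mass h t nu1).
rewrite mulr_suml; apply: eq_bigr => w _.
by rewrite big_tnth sumr_const card_ord size_tuple.
Qed.

Hypothesis trans_ge0 : forall x y a, 0 <= trans x y a.

(** If [F] is the one-step drift of [G], the total of [F] telescopes to the
    final expectation of [G] minus the initial one. Only the final expectation
    has to be bounded; conditioning on the first step propagates the bound, as
    the initial expectation of [G] for the remaining steps cancels against the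
    drift of the first one. *)
Lemma path_total_potential F G (B : R) h nu t :
  (forall x a, \sum_y trans x y a * G y = G x + F x a) ->
  (forall x, `|G x| <= B) ->
  (forall x, 0 <= nu x) -> \sum_x nu x = 1 ->
  `|path_total h nu F t + \sum_x nu x * G x| <= B.
Proof.
move=> driftG GB; elim: t h nu => [|t IH] h nu nu0 nu1.
  rewrite {1}/path_total big1 ?add0r => [|w _]; last first.
    by rewrite tuple0 big_nil mulr0.
  apply: le_trans (ler_norm_sum _ _ _) _; rewrite -[B]mul1r -nu1 mulr_suml.
  by apply: ler_sum => x _; rewrite normrM ger0_norm// ler_wpM2l.
rewrite path_total_recl -(sum_state_action h nu G) -big_split /=.
apply: le_trans (ler_norm_sum _ _ _) _; rewrite -[B]mul1r -nu1 mulr_suml.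
rewrite -(sum_state_action h nu (fun=> B)); apply: ler_sum => -[x a] _ /=.
rewrite -mulrDr normrM ger0_norm ?mulr_ge0 ?pol_ge0//.
rewrite ler_wpM2l ?mulr_ge0 ?pol_ge0//.
by rewrite addrAC addrC [F x a + _]addrC -driftG; apply: IH; rewrite ?sum_trans.
Qed.

End Trajectories.

(** * Transitions of the repair process *)

Section Drift.
Variables (R : realType) (V : finType) (P : repair_problem R V).
Implicit Types (x y : state P) (a : V) (j l : machine P) (F : state P -> R).

(** Values of [k] above [K j] are junk, since [inord] sends them to 0. *)
Definition set_condition x j (k : nat) : state P :=
  (x.1, [ffun l => if l == j then inord k else x.2 l]).

Lemma eq_set_condition x y j k : (k <= K j)%N ->
  (y == set_condition x j k) =
  [&& y.1 == x.1, (y.2 j == k :> nat) & [forall l, (l != j) ==> (y.2 l == x.2 l)]].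
Proof.
case: x y => [v c] [w d] kK; rewrite /set_condition xpair_eqE /=.
congr andb; apply/eqP/andP => [->|[/eqP dj /forallP dl]].
  split; first by rewrite ffunE eqxx inordK.
  by apply/forallP => l; apply/implyP => /negbTE lj; rewrite ffunE lj.
apply/ffunP => l; rewrite ffunE; case: eqP => [->|/eqP lj].
  by apply: val_inj; rewrite /= dj inordK.
by apply/eqP; exact: implyP (dl l) lj.
Qed.

Lemma degradesE x y j : degrades j x y =
  (x.2 j < K j)%N && (y == set_condition x j (x.2 j).+1).
Proof.
case: ltnP => [lt_xK|le_Kx]; first by rewrite eq_set_condition.
apply/negbTE/negP => /and3P[_ /eqP yj _].
by have := ltn_ord (y.2 j); rewrite yj ltnS ltnNge le_Kx.
Qed.

Lemma repairsE x y j : repairs j x y =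
  [&& x.1 == val j, (0 < x.2 j)%N & y == set_condition x j (x.2 j).-1].
Proof.
rewrite /repairs; congr andb; case: posnP => [->|x_gt0].
  by rewrite /= andbF.
rewrite eq_set_condition; last first.
  by rewrite -ltnS prednK// ltnW// ltn_ord.
by rewrite -[_ == _.-1]eqSS prednK// [(y.2 j).+1 == _]eq_sym.
Qed.

Lemma movesE x y a :
  moves x y && (a == y.1) = adj P x.1 a && (y == (a, x.2)).
Proof.
case: x y => [v c] [w d]; rewrite /moves /neighbours inE xpair_eqE /= [w == a]eq_sym.
by case: (eqVneq a w) => [->|]; rewrite ?andbF ?andbT.
Qed.

Lemma degrades_uniq x y j l : degrades j x y -> degrades l x y -> j = l.
Proof.
move=> /and3P[_ /eqP yj _] /and3P[_ _ /forallP/(_ j)].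
by case: eqVneq => //= _ /eqP yx; move: yj; rewrite yx => /n_Sn.
Qed.

Lemma degrades_repairs x y j l : degrades j x y -> repairs l x y -> False.
Proof.
move=> /and3P[_ /eqP yj _] /and4P[_ _ /eqP xl /forallP/(_ j)].
case: eqVneq => [jl|_] /=.
  by move=> _; rewrite jl xl in yj; have := leqnSn (y.2 l).+1; rewrite -yj ltnn.
by move=> /eqP yx; move: yj; rewrite yx => /n_Sn.
Qed.

(** The cases of [trans_neq] exclude one another: a degradation and a repair
    change conditions in opposite directions, a move changes none, and an action
    cannot both stay and move because the graph has no loops. *)
Lemma trans_neqE x y a : trans_neq x y a =
  \sum_(j | degrades j x y) lambda j +
  (\sum_(j | repairs j x y && (a == x.1)) mu j +
   (if moves x y && (a == y.1) then tau P else 0)).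
Proof.
rewrite /trans_neq; have rep_uniq j l : repairs j x y && (a == x.1) ->
    repairs l x y && (a == x.1) -> j = l.
  move=> /andP[/and4P[/eqP xj _ _ _] _] /andP[/and4P[/eqP xl _ _ _] _].
  by apply: val_inj; rewrite -xj -xl.
have rep_move : [exists j, repairs j x y && (a == x.1)] ->
    (if moves x y && (a == y.1) then tau P else 0) = 0.
  move=> /existsP[j /andP[_ /eqP ->]]; case: ifP => // /andP[/andP[+ _] /eqP xy].
  by rewrite inE -xy adj_irr.
rewrite (if_pick_sum _ rep_uniq rep_move); apply: if_pick_sum.
  by move=> j l; exact: degrades_uniq.
move=> /existsP[j deg_j]; rewrite big_pred0 => [|l]; last first.
  by apply/negP => /andP[+ _]; exact: degrades_repairs deg_j.
rewrite add0r; case: ifP => // /andP[/andP[_ /eqP yx] _].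
by case/and3P: deg_j => _ + _; rewrite yx => /eqP/n_Sn.
Qed.

Lemma sum_trans_neq x a F : \sum_y trans_neq x y a * F y =
  \sum_(j | (x.2 j < K j)%N) lambda j * F (set_condition x j (x.2 j).+1) +
  (\sum_(j | [&& x.1 == val j, (0 < x.2 j)%N & a == x.1])
     mu j * F (set_condition x j (x.2 j).-1) +
   (if adj P x.1 a then tau P * F (a, x.2) else 0)).
Proof.
under eq_bigr do rewrite trans_neqE !mulrDl !mulr_suml.
rewrite !big_split /= (exchange_big_dep xpredT) //=.
rewrite [X in _ + (X + _)](exchange_big_dep xpredT) //=.
congr (_ + (_ + _)).
- rewrite [RHS]big_mkcond; apply: eq_bigr => j _.
  under eq_bigl do rewrite degradesE.
  by case: ifP => _; [rewrite big_pred1_eq | rewrite big_pred0].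
- rewrite [RHS]big_mkcond; apply: eq_bigr => j _.
  case: ifP => able_j.
    rewrite (big_pred1 (set_condition x j (x.2 j).-1)) // => y; rewrite repairsE.
    by case/and3P: able_j => -> -> ->; rewrite andbT.
  rewrite big_pred0 // => y; rewrite repairsE.
  by apply: contraFF able_j => /andP[/and3P[-> -> _] ->].
- under eq_bigr do rewrite movesE (fun_if ( *%R^~ _)) mul0r.
  rewrite -big_mkcond /=.
  by case: ifP => _; [rewrite big_pred1_eq | rewrite big_pred0].
Qed.

Lemma trans_neq_ge0 x y a : 0 <= trans_neq x y a.
Proof.
rewrite /trans_neq; case: pickP => [j _|_]; first exact/ltW/lambda_gt0.
case: pickP => [j _|_]; first exact/ltW/mu_gt0.
by case: ifP => // _; exact/ltW/tau_gt0.
Qed.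

Lemma trans_neq_xx x a : trans_neq x x a = 0.
Proof.
rewrite trans_neqE !big_pred0 ?add0r => [|j|j].
- by rewrite /moves inE adj_irr.
- by apply/negP => /andP[/and4P[_ _ /eqP/n_Sn]].
- by apply/negP => /and3P[_ /eqP/n_Sn].
Qed.

(** An action allows either the repair of one machine or a single move, whence
    the maximum of the rates [mu] and [tau], rather than their sum, in the
    normalization of time. *)
Lemma sum_trans_neq_le1 x a : \sum_y trans_neq x y a <= 1.
Proof.
under eq_bigr do rewrite -[trans_neq _ _ _]mulr1.
rewrite (sum_trans_neq x a (fun=> 1)) -[leRHS](time_scale P); apply: lerD.
  rewrite big_mkcond; apply: ler_sum => j _; rewrite mulr1.
  by case: ifP => // _; exact/ltW/lambda_gt0.
case: ifP => [adj_xa|_]; rewrite ?addr0 ?mulr1.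
  rewrite big_pred0 ?add0r ?bigmax_ge_id// => j.
  by apply/negP => /and3P[_ _ /eqP ax]; rewrite ax adj_irr in adj_xa.
under eq_bigr do rewrite mulr1.
have tau_le : 0 <= \big[Num.max/tau P]_(j : machine P) mu j.
  by apply: le_trans (bigmax_ge_id _ _ _ _); exact/ltW/tau_gt0.
have := @if_pick_sum R (machine P)
  (fun j => [&& x.1 == val j, (0 < x.2 j)%N & a == x.1]) (@mu R V P) 0.
rewrite addr0 => <- //.
  by case: pickP => // j _; exact: le_bigmax.
move=> j l /andP[/eqP xj _] /andP[/eqP xl _].
by apply: val_inj; rewrite -xj -xl.
Qed.

Lemma trans_ge0 x y a : 0 <= trans x y a.
Proof.
rewrite /trans; case: eqP => [_|_]; last exact: trans_neq_ge0.
rewrite subr_ge0; apply: le_trans (sum_trans_neq_le1 x a).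
by rewrite [leRHS](bigD1 x) //= lerDr trans_neq_ge0.
Qed.

Lemma sum_transE x a F :
  \sum_y trans x y a * F y = F x + \sum_y trans_neq x y a * (F y - F x).
Proof.
rewrite (bigD1 x) //= [in RHS](bigD1 x) //= subrr mulr0 add0r.
rewrite {1}/trans eqxx mulrBl mul1r mulr_suml -addrA; congr (_ + _).
rewrite addrC -sumrB; apply: eq_bigr => y /negbTE yx.
by rewrite /trans yx mulrBr.
Qed.

(** Solves [lambda j * (phi (k + 1) - phi k) = f_j(k) - f_j(K_j)] with
    [phi 0 = 0]. *)
Definition level_potential j (k : nat) : R :=
  - \sum_(i < k) (cost P j ord_max - cost P j (inord i)) / lambda j.

Definition potential x : R := \sum_j level_potential j (x.2 j).

Lemma potential_set_condition x j k : (k <= K j)%N ->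
  potential (set_condition x j k) - potential x =
  level_potential j k - level_potential j (x.2 j).
Proof.
move=> kK; rewrite /potential -sumrB (bigD1 j) //= ffunE eqxx inordK//.
rewrite big1 ?addr0// => l /negbTE lj.
by rewrite ffunE lj subrr.
Qed.

Lemma level_potentialS j k :
  level_potential j k.+1 - level_potential j k =
  (cost P j (inord k) - cost P j ord_max) / lambda j.
Proof. by rewrite /level_potential big_ord_recr /=; ring. Qed.

Lemma rewardE x a : reward x a =
  \sum_(j | [&& x.1 == val j, (0 < x.2 j)%N & a == x.1])
    mu j / lambda j * (cost P j ord_max - cost P j (inord (x.2 j).-1)).
Proof.
rewrite /reward if_pick_sum ?addr0// => j l /andP[/eqP xj _] /andP[/eqP xl _].
by apply: val_inj; rewrite -xj -xl.
Qed.

Definition max_cost : R := \sum_j cost P j ord_max.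

(** Degradation contributes the cost minus [max_cost], and repair contributes
    the reward. *)
Lemma drift_potential x a :
  \sum_y trans x y a * potential y =
  potential x + (state_cost x + reward x a + - max_cost).
Proof.
rewrite sum_transE; congr (_ + _).
rewrite (sum_trans_neq x a (fun y => potential y - potential x)).
have -> : potential (a, x.2) = potential x by [].
rewrite subrr mulr0 if_same addr0 addrAC; congr (_ + _).
  rewrite /state_cost /max_cost -sumrB [LHS]big_mkcond; apply: eq_bigr => j _.
  case: ltnP => [lt_xK|le_Kx].
    rewrite potential_set_condition// level_potentialS inord_val mulrC divfK//.
    by rewrite gt_eqF ?lambda_gt0.
  (* No degradation is possible here; the term vanishes on the other side too,
     because the cost is already the maximal one. *)
  have -> : x.2 j = ord_max.
    by apply: val_inj; apply/eqP; rewrite eqn_leq le_Kx -ltnS ltn_ord.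
  by rewrite subrr.
rewrite rewardE; apply: eq_bigr => j /and3P[_ x_gt0 _].
rewrite potential_set_condition; last by rewrite -ltnS prednK// ltnW.
have := level_potentialS j (x.2 j).-1; rewrite prednK// => step.
by rewrite -(opprB (level_potential j (x.2 j))) step; ring.
Qed.

(** The left-hand side is the expected change of the potential over [t] steps,
    and the potential takes finitely many values; hence the uniformity of [B] in
    the policy and in the horizon. *)
Lemma expected_total_balance : exists2 B : R, 0 <= B &
  forall (theta : policy P) x t,
  `|expected_total theta (fun y _ => state_cost y) x t +
    expected_total theta (@reward R V P) x t - t%:R * max_cost| <= B.
Proof.
pose B : R := \sum_y `|potential y|.
have potB y : `|potential y| <= B.
  by rewrite /B (bigD1 y) //= lerDl sumr_ge0.
exists (B + B) => [|theta x t]; first by rewrite addr_ge0// sumr_ge0.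
have nu1 : \sum_y (y == x)%:R = 1 :> R.
  by rewrite (bigD1 x) //= eqxx big1 ?addr0// => y /negbTE ->.
have := path_total_potential theta trans_ge0 [::] t
  drift_potential potB (fun y => ler0n R (y == x)) nu1.
rewrite !path_totalD path_total_cst// -!expected_totalE => bal.
have sumG : \sum_y (y == x)%:R * potential y = potential x.
  rewrite (bigD1 x) //= eqxx mul1r big1 ?addr0// => y /negbTE ->.
  by rewrite mul0r.
rewrite sumG mulrN in bal.
apply: le_trans (lerD bal (potB x)).
by rewrite -{1}[X in `|X|](addrK (potential x)) ler_normB.
Qed.

(** The two averages taken at the same horizon add up to [max_cost] plus a
    vanishing error, so the smallest limit point of the one is [max_cost] minus
    the largest limit point of the other. *)
Lemma avg_costE (theta : policy P) x :
  avg_cost theta x = (max_cost%:E - avg_reward theta x)%E.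
Proof.
have [B B0 bal] := expected_total_balance.
pose avg r t : R := t%:R^-1 * expected_total theta r x t.
pose C t := avg (fun y _ => state_cost y) t; pose W := avg (@reward R V P).
have near_balance (e : R) : 0 < e ->
    \forall t \near \oo%classic, `|C t + W t - max_cost| <= e.
  move=> e0; near=> t; have Bt : B / e < t%:R.
    by near: t; exact: nbhs_infty_gtr.
  have t0 : 0 < t%:R :> R by apply: le_lt_trans Bt; rewrite divr_ge0// ltW.
  have -> : C t + W t - max_cost = t%:R^-1 *
      (expected_total theta (fun y _ => state_cost y) x t +
       expected_total theta (@reward R V P) x t - t%:R * max_cost).
    by rewrite /C /W /avg; field; rewrite gt_eqF.
  rewrite normrM gtr0_norm ?invr_gt0// ler_pdivrMl//.
  by apply: le_trans (bal theta x t) _; rewrite -ler_pdivrMr// ltW.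
have leCW : (limn_esup (fun t => (- C t)%:E) <=
             limn_esup (fun t => (W t)%:E) + (- max_cost)%:E)%E.
  apply: le_limn_esup_near => e /near_balance; apply: filterS => t.
  by rewrite ler_norml => /andP[? ?]; lra.
have leWC : (limn_esup (fun t => (W t)%:E) <=
             limn_esup (fun t => (- C t)%:E) + max_cost%:E)%E.
  apply: le_limn_esup_near => e /near_balance; apply: filterS => t.
  by rewrite ler_norml => /andP[? ?]; lra.
have -> : avg_reward theta x =
    (limn_esup (fun t => (- C t)%:E) + max_cost%:E)%E.
  apply/eqP; rewrite eq_le leWC /=.
  by rewrite -leeBrDr.
rewrite fin_num_oppeD// addeCA -EFinN subee// adde0.
by congr (- limn_esup _)%E; apply/funext => t; rewrite EFinN.
Unshelve. all: by end_near. Qed.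

End Drift.

Theorem corollary4p2 (R : realType) (V : finType) (P : repair_problem R V)
    (theta : policy P) :
  stationary theta -> maximizes_avg_reward theta -> minimizes_avg_cost theta.
Proof.
move=> _ theta_max theta' x; rewrite !avg_costE.
exact: leeB (lexx _) (theta_max theta' x).
Qed.
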